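(* Let $X$ be a Banach space. The following are equivalent. (A) There exist a basic sequence $(x_n)$ in $X$ and a bounded linear operator $T:[(x_n)]\to X$ such that $T$ is not of the form $\lambda i_{[(x_n)]\to X}+K$ with $\lambda$ a scalar and $K:[(x_n)]\to X$ compact. (B) There exist a seminormalized basic sequence $(x_n)$ in $X$ and a sequence $(y_n)$ in $X$ such that $(x_n)$ dominates $(y_n)$ and one of the following three happens: (i) for all scalars $\lambda$, $(y_n-\lambda x_n)_n$ has no converging subsequence; (ii) there exists a scalar $\lambda$ such that $(y_n-\lambda x_n)_n$ converges and there exists a bounded sequence $(z_n)\subseteq\operatorname{span}(x_i)_{i=1}^\infty$ such that $(w_n-\lambda z_n)_n$ has no converging subsequence, where each $w_n\in\operatorname{span}(y_i)_{i=1}^\infty$ has the same distribution with respect to $(y_i)_i$ as $z_n$ has with respect to $(x_i)_i$; (iii) there exist scalars $\lambda_1\ne\lambda_2$ and increasing sequences $(k^1_n)_n$, $(k^2_n)_n$ of positive integers such that $(y_{k^i_n}-\lambda_ix_{k^i_n})_n$ converges for $i\in\{1,2\}$.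
   Context: $[(x_n)]$ denotes the closed linear span of $(x_n)$, and $i_{[(x_n)]\to X}$ the inclusion map. ''$(x_n)$ dominates $(y_n)$'' means there is a constant $K$ with $\|\sum a_ny_n\|\le K\|\sum a_nx_n\|$ for all finitely supported scalar sequences $(a_n)$. ''$w_n$ has the same distribution with respect to $(y_i)$ as $z_n$ has with respect to $(x_i)$'' means: if $z_n=\sum_i a_ix_i$ (finite sum) then $w_n=\sum_i a_iy_i$. Convergence is in norm. *)

(* Defs.v *)
From HB Require Import structures.
From mathcomp Require Import all_boot all_order all_algebra.
From mathcomp.real_closed Require Import complex.
From mathcomp Require Import all_classical all_reals all_analysis.

Set Implicit Arguments.
Unset Strict Implicit.
Unset Printing Implicit Defensive.

Import Order.TTheory GRing.Theory Num.Theory.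
Import numFieldNormedType.Exports.

Local Open Scope classical_set_scope.
Local Open Scope ring_scope.

(* The scalar field K is kept abstract so that real (K := R) and complex
   (K := R[i]) Banach spaces are treated by the same definitions. Norms take
   their values in K, so for K := R[i] every bound below is an inequality for
   the partial order of R[i]: `0 <= c` implies that c is real. *)
Section Definitions.
Context {K : numFieldType} {X : completeNormedModType K}.
Implicit Types (x y : nat -> X) (V : set X) (T : X -> X).

Definition lspan x : set X :=
  [set v | exists N (a : nat -> K), v = \sum_(i < N) a i *: x i].

Definition closed_span x : set X := closure (lspan x).

(* x is a Schauder basis of its closed linear span. *)
Definition basic_sequence x : Prop :=
  forall v, closed_span x v ->
    exists! a : nat -> K, series (fun i => a i *: x i) @ \oo --> v.

Definition seminormalized x : Prop :=
  exists c C : K, 0 < c /\ forall n, c <= `|x n| <= C.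

Definition dominates x y : Prop :=
  exists C : K, forall N (a : nat -> K),
    `|\sum_(i < N) a i *: y i| <= C * `|\sum_(i < N) a i *: x i|.

(* An operator V -> X on a subspace V of X is represented by a function X -> X
   of which only the values on V are ever constrained or used; it is not
   required to extend to an operator on X. *)
Definition bounded_operator_on V T : Prop :=
  (forall (a : K) (u v : X), V u -> V v -> T (a *: u + v) = a *: T u + T v) /\
  (exists C : K, forall v, V v -> `|T v| <= C * `|v|).

Definition compact_operator_on V T : Prop :=
  bounded_operator_on V T /\
  precompact (T @` [set v | V v /\ `|v| <= 1]).

Definition scalar_plus_compact_on V T : Prop :=
  exists (l : K) (S : X -> X),
    compact_operator_on V S /\ forall v, V v -> T v = l *: v + S v.

Definition has_converging_subsequence (u : nat -> X) : Prop :=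
  exists k : nat -> nat, increasing_seq k /\ cvgn (u \o k).

(* w has the same distribution with respect to y as z has with respect to x. *)
Definition same_distribution x (z : X) y (w : X) : Prop :=
  forall N (a : nat -> K),
    z = \sum_(i < N) a i *: x i -> w = \sum_(i < N) a i *: y i.

End Definitions.

Section Conditions.
Context {K : numFieldType} (X : completeNormedModType K).

Definition has_nontrivial_operator : Prop :=
  exists (x : nat -> X) (T : X -> X),
    [/\ basic_sequence x,
        bounded_operator_on (closed_span x) T
      & ~ scalar_plus_compact_on (closed_span x) T].

Definition no_scalar_subsequence (x y : nat -> X) : Prop :=
  forall l : K, ~ has_converging_subsequence (fun n => y n - l *: x n).

Definition scalar_limit_noncompact (x y : nat -> X) : Prop :=
  exists l : K,
    cvgn (fun n => y n - l *: x n) /\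
    exists z w : nat -> X,
      [/\ bounded_fun z,
          forall n, lspan x (z n),
          forall n, lspan y (w n),
          forall n, same_distribution x (z n) y (w n)
        & ~ has_converging_subsequence (fun n => w n - l *: z n)].

Definition two_scalar_limits (x y : nat -> X) : Prop :=
  exists (l1 l2 : K) (k1 k2 : nat -> nat),
    [/\ l1 != l2,
        increasing_seq k1, increasing_seq k2,
        cvgn (fun n => y (k1 n) - l1 *: x (k1 n))
      & cvgn (fun n => y (k2 n) - l2 *: x (k2 n))].

Definition has_nontrivial_dominated_sequence : Prop :=
  exists x y : nat -> X,
    [/\ basic_sequence x, seminormalized x, dominates x y
      & [\/ no_scalar_subsequence x y,
            scalar_limit_noncompact x y
          | two_scalar_limits x y]].

End Conditions.

(* Main.v *)
Require Import Defs.
From mathcomp Require Import all_boot all_order all_algebra.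
From mathcomp.real_closed Require Import complex.
From mathcomp Require Import all_classical all_reals all_analysis.
From mathcomp Require Import ring lra.

(** The proof works for any scalar field that resembles the real numbers
    closely enough to carry real-valued norms, and is instantiated at the end
    with the real and the complex numbers.

    The workhorse is the characterization of basic sequences by a basis
    constant: a sequence of nonzero vectors is basic exactly when the partial
    sum projections on its linear span are uniformly bounded.  One direction
    ([basis_constant_of_basic]) is the theorem of Banach: by the theorem of
    Baire and the iteration that proves the open mapping theorem, every vector
    has an expansion whose partial sums are controlled by its norm, and
    expansions are unique.  The other one ([basic_of_basis_constant]) is the
    criterion of Grunblum.  It follows that vectors with successive supports in
    a basic sequence form again a basic sequence.

    From a dominated sequence to an operator: the map [x i |-> y i] extends to
    a bounded operator [T] on the closed span.  If [T] were [l] plus a compact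
    operator [S], then [S] would map bounded sequences to sequences with
    convergent subsequences.  So [y n - l *: x n] has a convergent subsequence,
    which excludes the first alternative.  Moreover, if [y n - m *: x n]
    converges along a subsequence, then so does [(m - l) *: x n], whence
    [m = l] because the terms of a seminormalized basic sequence stay apart.
    This excludes two different scalars, and in the remaining alternative it
    identifies the scalar with [l], so that the sequence which is required to
    have no convergent subsequence is the image by [S] of a bounded one.

    From an operator [T] to a dominated sequence: let [x2] be a normalized
    subsequence of [x].  Either the pair [(x2, T \o x2)] satisfies the first
    alternative, or [T - l] has a limit along a subsequence of [x2] for some
    scalar [l].  The operator [S = T - l] is not compact, and since the heads
    of vectors range over finite-dimensional spaces, it stays uniformly far
    from compact on all tails of [x] ([noncompact_on_tails]).  Hence there is a
    block sequence [u] in the unit ball whose image by [S] is separated.  Again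
    either [(u, T \o u)] satisfies the first alternative, or [T - m] has a
    limit along a subsequence of [u], where [m] differs from [l] because
    [S \o u] is separated.  In that case both subsequences can be interleaved
    to a single block sequence ([block_extraction]), which has the two
    different scalars [l] and [m] as limits along its even and odd terms. *)

Set Implicit Arguments.
Unset Strict Implicit.
Unset Printing Implicit Defensive.

Import Order.TTheory GRing.Theory Num.Theory.
Import numFieldNormedType.Exports.

Local Open Scope classical_set_scope.
Local Open Scope ring_scope.

(** * Scalars with real absolute values *)

(** The sequences to which this is applied are nonincreasing, so that a single
    small term makes all later ones small. *)
Definition vanishing (R : realType) (r : nat -> R) :=
  (forall n, 0 <= r n) /\ (forall e : R, 0 < e -> exists n, r n < e).

(** [iota] embeds the reals into the scalars and [rho] recovers real scalars, so
    that all estimates can be made in the totally ordered field [R]: the order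
    of the complex numbers is only partial.  The last two fields are what the
    proof uses of the completeness and of the local compactness of the scalars;
    the factor 2 makes room for arguing on real and imaginary parts. *)
Record real_like_scalars (R : realType) (K : numFieldType)
    (iota : {rmorphism R -> K}) (rho : K -> R) : Prop := RealLikeScalars {
  iota_le : forall s t, (iota s <= iota t) = (s <= t);
  rhoK : forall k, k \is Num.real -> iota (rho k) = k;
  scalar_complete : forall (u : nat -> K) (r : nat -> R),
    (forall n, rho `|u n.+1 - u n| <= r n - r n.+1) ->
    vanishing r -> exists l, forall n, rho `|l - u n| <= 2 * r n;
  scalar_net : forall C e : R, 0 < e ->
    exists s : seq K, forall a, rho `|a| <= C ->
      exists2 b, b \in s & rho `|a - b| <= e }.

Section RealNorm.
Context {R : realType} {K : numFieldType} {iota : {rmorphism R -> K}}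
  {rho : K -> R} (HK : real_like_scalars iota rho).

Definition nm (V : normedZmodType K) (v : V) : R := rho `|v|.

Lemma iota_nm (V : normedZmodType K) (v : V) : iota (nm v) = `|v|.
Proof. exact/(rhoK HK)/normr_real. Qed.

Lemma iota_inj : injective iota.
Proof. exact: fmorph_inj. Qed.

Lemma iota_lt s t : (iota s < iota t) = (s < t).
Proof. by rewrite !lt_neqAle (iota_le HK) (inj_eq iota_inj). Qed.

Lemma iota_gt0 s : (0 < iota s) = (0 < s).
Proof. by rewrite -(rmorph0 iota) iota_lt. Qed.

Lemma iota_gt0P k : 0 < k -> exists2 e, 0 < e & k = iota e.
Proof.
move=> k0; have e : iota (rho k) = k by apply/(rhoK HK)/gtr0_real.
by exists (rho k); rewrite -?iota_gt0 e.
Qed.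

Section Zmod.
Context {V : normedZmodType K}.
Implicit Types u v w : V.

Lemma nm_le v s : (`|v| <= iota s) = (nm v <= s).
Proof. by rewrite -iota_nm (iota_le HK). Qed.

Lemma nm_lt v s : (`|v| < iota s) = (nm v < s).
Proof. by rewrite -iota_nm iota_lt. Qed.

Lemma nm_ge0 v : 0 <= nm v.
Proof. by rewrite -(iota_le HK) iota_nm rmorph0. Qed.

Lemma nmr0 : nm (0 : V) = 0.
Proof. by apply: iota_inj; rewrite iota_nm normr0 rmorph0. Qed.

Lemma nm_eq0 v : (nm v == 0) = (v == 0).
Proof. by rewrite -(inj_eq iota_inj) iota_nm rmorph0 normr_eq0. Qed.

Lemma nm_gt0 v : (0 < nm v) = (v != 0).
Proof. by rewrite lt_def nm_eq0 nm_ge0 andbT. Qed.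

Lemma nmD u v : nm (u + v) <= nm u + nm v.
Proof. by rewrite -(iota_le HK) rmorphD !iota_nm ler_normD. Qed.

Lemma nmN v : nm (- v) = nm v.
Proof. by rewrite /nm normrN. Qed.

Lemma nmBC u v : nm (u - v) = nm (v - u).
Proof. by rewrite -nmN opprB. Qed.

Lemma nmB u v : nm (u - v) <= nm u + nm v.
Proof. by rewrite -(nmN v) nmD. Qed.

Lemma nm_tri u v w : nm (u - w) <= nm (u - v) + nm (v - w).
Proof. by rewrite -[u - w](subrKA v) nmD. Qed.

Lemma nm_sum I (s : seq I) (P : pred I) (F : I -> V) :
  nm (\sum_(i <- s | P i) F i) <= \sum_(i <- s | P i) nm (F i).
Proof.
apply: (big_ind2 (fun v t => nm v <= t)) => [|u s1 v t us vt|//].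
  by rewrite nmr0.
by rewrite (le_trans (nmD _ _))// lerD.
Qed.

Lemma nm_small v : (forall e : R, 0 < e -> nm v <= e) -> v = 0.
Proof.
move=> h; apply/eqP; rewrite -nm_eq0; apply/eqP/le_anti.
by rewrite nm_ge0 andbT; apply/ler_addgt0Pr => e e0; rewrite add0r h.
Qed.

Lemma nm_le_nm v (c : K) : `|v| <= c -> nm v <= nm c.
Proof.
by move=> vc; rewrite -(iota_le HK) !iota_nm ger0_norm// (le_trans _ vc).
Qed.

End Zmod.

Lemma nm_iota s : nm (iota s) = `|s|.
Proof.
apply: iota_inj; rewrite iota_nm.
have [s0|s0] := leP 0 s.
  by rewrite !ger0_norm// -(rmorph0 iota) (iota_le HK).
rewrite !ltr0_norm ?rmorphN//.
by rewrite -(rmorph0 iota) iota_lt.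
Qed.

Lemma nmM (a b : K) : nm (a * b) = nm a * nm b.
Proof. by apply: iota_inj; rewrite rmorphM !iota_nm normrM. Qed.

Lemma nmZ (V : normedModType K) (a : K) (v : V) : nm (a *: v) = nm a * nm v.
Proof. by apply: iota_inj; rewrite rmorphM !iota_nm normrZ. Qed.

(** The scalar [c] need not be real when [v] is zero, which is why its absolute
    value appears in the conclusion. *)
Lemma nm_le_mul (V W : normedZmodType K) (u : V) (v : W) (c : K) :
  `|u| <= c * `|v| -> nm u <= nm c * nm v.
Proof.
by move=> /nm_le_nm; rewrite nmM [nm `|v|](_ : _ = nm v)// /nm normr_id.
Qed.

Lemma geometric_lt (c e : R) : 0 < e -> exists n, c * 2^-1 ^+ n < e.
Proof.
move=> e0; have h : (fun n => c * 2^-1 ^+ n) @ \oo --> c * 0.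
  apply: cvgM; first exact: cvg_cst.
  by apply: cvg_expr; rewrite ger0_norm ?invr_ge0// invf_lt1// ltr1n.
rewrite mulr0 in h.
have /cvgrPdist_lt/(_ _ e0)[n _ /(_ n (leqnn n))/=] := h.
rewrite sub0r normrN => hn; exists n; exact: le_lt_trans (ler_norm _) hn.
Qed.

(** * Topology in terms of real norms *)

Section Topology.
Context {X : completeNormedModType K}.
Implicit Types (A : set X).

Lemma cvg_nmP (u : nat -> X) l : u @ \oo --> l <->
  forall e : R, 0 < e -> exists n0, forall n, (n0 <= n)%N -> nm (l - u n) < e.
Proof.
split=> [/cvgrPdist_lt h e e0|h].
  have /h[n0 _ hn] : 0 < iota e by rewrite iota_gt0.
  by exists n0 => n nn; rewrite -nm_lt; exact: hn.
apply/cvgrPdist_lt => _ /iota_gt0P[e /h[n0 hn] ->].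
by exists n0 => // n /= nn; rewrite nm_lt hn.
Qed.

Lemma ball_iota (x y : X) (e : R) : ball x (iota e) y <-> nm (x - y) < e.
Proof. by rewrite -nm_lt -ball_normE. Qed.

Lemma closure_nmP A v : closure A v <->
  forall e : R, 0 < e -> exists2 w, A w & nm (v - w) < e.
Proof.
split=> [h e e0|h B].
  have /h[w [Aw /ball_iota]] : nbhs v (ball v (iota e)).
    by apply: nbhsx_ballx; rewrite iota_gt0.
  by exists w.
move=> /nbhs_ballP[_ /= /iota_gt0P[e /h[w Aw vw] ->]] eB.
by exists w; split=> //; apply/eB/ball_iota.
Qed.

Lemma cvg_nm_cauchy (u : nat -> X) :
  (forall e : R, 0 < e ->
    exists m, forall n, (m <= n)%N -> nm (u m - u n) < e) ->
  exists l : X, u @ \oo --> l.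
Proof.
move=> h; suff : cvgn u by move=> ?; exists (limn u).
apply: cauchy_cvg; apply: cauchy_exP => _ /iota_gt0P[e /h[m hm] ->].
by exists (u m); exists m => // n mn; apply/ball_iota/hm.
Qed.

(** A series whose terms are majorized by those of a convergent telescoping
   series converges, and the remainders of the majorant control the rate. *)
Lemma telescoping_cvg (u : nat -> X) (r : nat -> R) :
  (forall n, nm (u n.+1 - u n) <= r n - r n.+1) -> vanishing r ->
  exists2 l : X, u @ \oo --> l & forall n, nm (l - u n) <= r n.
Proof.
move=> ur [rge0 r0].
have uD n p : nm (u n - u (n + p)%N) <= r n - r (n + p)%N.
  elim: p => [|p IH]; first by rewrite addn0 !subrr nmr0.
  rewrite addnS; have := nm_tri (u n) (u (n + p)%N) (u (n + p).+1).
  by rewrite (nmBC (u (n + p)%N)); have := ur (n + p)%N; lra.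
have uP n m : (n <= m)%N -> nm (u n - u m) <= r n.
  move=> le_nm; have := uD n (m - n)%N; rewrite subnKC//.
  by have := rge0 m; lra.
have [|l ul] := @cvg_nm_cauchy u.
  by move=> e /r0[m rm]; exists m => n mn; apply: le_lt_trans rm; exact: uP.
exists l => // n; apply/ler_addgt0Pr => e e0.
have [m hm] := (cvg_nmP _ _).1 ul _ e0.
have := nm_tri l (u (n + m)%N) (u n); rewrite (nmBC (u (n + m)%N)).
have := hm (n + m)%N (leq_addl _ _); have := uP n (n + m)%N (leq_addr _ _); lra.
Qed.

Definition totally_bounded A := forall e : R, 0 < e ->
  exists D : seq X, forall v, A v -> exists2 d, d \in D & nm (v - d) < e.

(** An ultrafilter containing [A] selects one ball from each finite net of [A],
    so it is a Cauchy filter, and it converges by completeness. *)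
Lemma precompact_of_totally_bounded A : totally_bounded A -> precompact A.
Proof.
move=> Atb; rewrite precompactE compact_ultra => F FU FA.
have FP : ProperFilter F := @ultra_proper _ _ FU.
have Fc : cauchy F.
  apply: cauchy_exP => _ /iota_gt0P[e e0 ->].
  have [D hD] := Atb (e / 2) ltac:(lra).
  suff [d _ Fd] : exists2 d, d \in D & F (ball d (iota e)) by exists d.
  have : F [set v | exists2 d, d \in D & nm (v - d) < e].
    apply: filterS FA => v /closure_nmP/(_ (e / 2))[|w /hD[d dD wd] vw].
      by lra.
    by exists d => //; have := nm_tri v w d; lra.
  elim: D {hD} => [|d D IH] FD.
    by exfalso; apply: (@filter_not_empty _ F); apply: filterS FD => v [].
  have [Fd|Fd] := in_ultra_setVsetC (ball d (iota e)) FU.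
    by exists d; rewrite ?mem_head.
  have [|d' d'D Fd'] := IH; last by exists d' => //; rewrite inE d'D orbT.
  apply: filterS (filterI FD Fd) => v [[d' + vd'] nd].
  rewrite inE => /predU1P[dd|d'D]; last by exists d'.
  by case: nd; apply/ball_iota; rewrite nmBC -dd.
have /cvg_ex[p Fp] : cvg F by exact: cauchy_cvg.
exists p; split=> //; apply: closed_closure => B /Fp FB.
exact: filter_ex (filterI FA FB).
Qed.

Lemma precompact_subsequence A (u : nat -> X) :
  precompact A -> (forall n, A (u n)) -> has_converging_subsequence u.
Proof.
rewrite precompactE => Aco uA.
have [|p [_ up]] := Aco (u @ \oo) _.
  by exists 0%N => // n _; exact/subset_closure.
have near_p (e : R) n : 0 < e -> exists m, (n <= m)%N /\ nm (p - u m) < e.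
  move=> e0; have /up : (u @ \oo) [set u m | m in [set m | (n <= m)%N]].
    by exists n => // m /= le_nm; exists m.
  move=> /(_ (ball p (iota e)))[|_ [[m le_nm <-] /ball_iota pm]].
    by apply: nbhsx_ballx; rewrite iota_gt0.
  by exists m.
have half_gt0 n : 0 < 2^-1 ^+ n :> R by rewrite exprn_gt0// invr_gt0.
pose next nk := projT1 (cid (near_p (2^-1 ^+ nk.1) nk.2 (half_gt0 _))).
have nextP n k : (k <= next (n, k))%N /\ nm (p - u (next (n, k))) < 2^-1 ^+ n.
  by rewrite /next; case: cid.
pose fix k n := if n is n'.+1 then next (n, (k n').+1) else next (0%N, 0%N).
have kP n : nm (p - u (k n)) < 2^-1 ^+ n.
  by case: n => [|n]; apply: (nextP _ _).2.
exists k; split.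
  by apply/increasing_seqP => n; exact: (nextP n.+1 (k n).+1).1.
apply/cvg_ex; exists p; apply/cvg_nmP => e e0.
have [n0] := geometric_lt 1 e0; rewrite mul1r => hn0.
exists n0 => n nn; apply: lt_le_trans (kP n) _; apply: le_trans (ltW hn0).
by apply: ler_wiXn2l => //; rewrite ?invr_ge0// invf_le1// ler1n.
Qed.

(** * Expansions and basis constants *)

Definition psum (x : nat -> X) (a : nat -> K) (n : nat) : X :=
  \sum_(i < n) a i *: x i.

Implicit Types (u v : X) (x : nat -> X) (a b : nat -> K).

Lemma series_psum x a : series (fun i => a i *: x i) = psum x a.
Proof. by apply/funext => n; rewrite /series/= big_mkord. Qed.

Lemma psumS x a n : psum x a n.+1 = psum x a n + a n *: x n.
Proof. by rewrite /psum big_ord_recr. Qed.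

Lemma psumD x a b n :
  psum x (fun i => a i + b i) n = psum x a n + psum x b n.
Proof.
by rewrite /psum -big_split/=; apply: eq_bigr => i _;
  rewrite scalerDl.
Qed.

Lemma psumZ x a c n : psum x (fun i => c * a i) n = c *: psum x a n.
Proof.
by rewrite /psum scaler_sumr; apply: eq_bigr => i _;
  rewrite scalerA.
Qed.

Lemma psumB x a b n :
  psum x (fun i => a i - b i) n = psum x a n - psum x b n.
Proof. by rewrite /psum -sumrB; apply: eq_bigr => i _; rewrite scalerBl. Qed.

Lemma psum_split x a p q : (p <= q)%N ->
  psum x a q = psum x a p + \sum_(p <= i < q) a i *: x i.
Proof.
move=> pq; rewrite /psum -!(big_mkord predT (fun i => a i *: x i)).
by rewrite -big_cat_nat.
Qed.

Lemma psum_stable x a p q : (p <= q)%N -> (forall i, (p <= i)%N -> a i = 0) ->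
  psum x a q = psum x a p.
Proof.
move=> pq a0; rewrite (psum_split _ _ pq) big_nat big1 ?addr0// => i /andP[pi _].
by rewrite a0// scale0r.
Qed.

Lemma psum_eq0 x a p : (forall i, (i < p)%N -> a i = 0) -> psum x a p = 0.
Proof. by move=> a0; rewrite /psum big1// => i _; rewrite a0// scale0r. Qed.

Lemma psum_unit x i n : (i < n)%N -> psum x (fun j => (j == i)%:R) n = x i.
Proof.
move=> ilt; rewrite /psum (bigD1 (Ordinal ilt))//= eqxx scale1r big1 ?addr0//.
by move=> j; rewrite -val_eqE/= => /negbTE ->; rewrite scale0r.
Qed.

Lemma cvg_stable (u : nat -> X) m l : (forall n, (m <= n)%N -> u n = l) ->
  u @ \oo --> l.
Proof.
by move=> h; apply/cvg_nmP => e e0; exists m => n /h ->; rewrite subrr nmr0.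
Qed.

(** The zero coordinates are prescribed rather than left out of the sum, so that
    vectors with different supports can be added coordinatewise. *)
Definition supported x p q : set X := [set v | exists2 a,
  forall i, (i < p)%N || (q <= i)%N -> a i = 0 & v = psum x a q].

Lemma supported_widen x p q p' q' v : (p' <= p)%N -> (q <= q')%N ->
  supported x p q v -> supported x p' q' v.
Proof.
move=> pp qq [a a0 ->]; exists a.
  move=> i /orP[ip|iq]; apply: a0; first by rewrite (leq_trans ip).
  by rewrite (leq_trans qq) ?orbT.
by apply/esym/psum_stable => // i iq; rewrite a0// iq orbT.
Qed.

Lemma supportedD x p q u v :
  supported x p q u -> supported x p q v -> supported x p q (u + v).
Proof.
move=> [a a0 ->] [b b0 ->]; exists (fun i => a i + b i); last by rewrite psumD.
by move=> i pi; rewrite a0// b0// addr0.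
Qed.

Lemma supportedZ x p q c v : supported x p q v -> supported x p q (c *: v).
Proof.
move=> [a a0 ->]; exists (fun i => c * a i); last by rewrite psumZ.
by move=> i pi; rewrite a0// mulr0.
Qed.

Lemma supported0 x p q : supported x p q 0.
Proof. by exists (fun=> 0) => //; rewrite psum_eq0. Qed.

Lemma supported_unit x p q i : (p <= i)%N -> (i < q)%N -> supported x p q (x i).
Proof.
move=> pi iq; exists (fun j => (j == i)%:R); last by rewrite psum_unit.
by move=> j; case: eqP => // ->; rewrite ltnNge pi leqNgt iq.
Qed.

Lemma supported_psum x a n : supported x 0 n (psum x a n).
Proof.
exists (fun i => if (i < n)%N then a i else 0).
  by move=> i /= ni; rewrite ltnNge ni.
by apply: eq_bigr => i _; rewrite ltn_ord.
Qed.

(** The head is given by the coordinates of the whole vector, which makes the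
    bounds on coordinates available for it. *)
Lemma supported_split x p q v : (p <= q)%N -> supported x 0 q v ->
  exists a g, [/\ supported x p q g, v = psum x a p + g & v = psum x a q].
Proof.
move=> pq [a a0 ->]; exists a, (\sum_(p <= i < q) a i *: x i); split=> //.
- exists (fun i => if (p <= i < q)%N then a i else 0).
    move=> i /orP[ip|qi]; first by rewrite leqNgt ip.
    by rewrite (ltnNge i) qi andbF.
  rewrite (psum_split _ _ pq) psum_eq0 ?add0r => [|i ip].
    by rewrite !big_nat; apply: eq_bigr => i ->.
  by rewrite leqNgt ip.
- exact: psum_split.
Qed.

Lemma lspanP x v : lspan x v <-> exists q, supported x 0 q v.
Proof.
split=> [[q [a ->]]|[q [a _ ->]]]; last by exists q, a.
by exists q; exact: supported_psum.
Qed.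

Lemma lspan_lin x c u v : lspan x u -> lspan x v -> lspan x (c *: u + v).
Proof.
move=> /lspanP[p up] /lspanP[q vq]; apply/lspanP; exists (maxn p q).
apply: supportedD; first apply: supportedZ.
  by apply: supported_widen up; rewrite ?leq_maxl.
by apply: supported_widen vq; rewrite ?leq_maxr.
Qed.

Lemma closed_span_lspan x v : lspan x v -> closed_span x v.
Proof. exact: subset_closure. Qed.

Lemma closed_span_psum x a n : closed_span x (psum x a n).
Proof. by apply: closed_span_lspan; exists n, a. Qed.

Lemma closed_span_lin x c u v :
  closed_span x u -> closed_span x v -> closed_span x (c *: u + v).
Proof.
move=> /closure_nmP hu /closure_nmP hv; apply/closure_nmP => e e0.
have c0 : 0 <= nm c by exact: nm_ge0.
have [u' su' uu'] := hu (e / 2 / (nm c + 1)) ltac:(by rewrite !divr_gt0//; lra).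
have [v' sv' vv'] := hv (e / 2) ltac:(lra).
exists (c *: u' + v'); first exact: lspan_lin.
rewrite opprD addrACA -scalerBr; apply: le_lt_trans (nmD _ _) _; rewrite nmZ.
suff : nm c * nm (u - u') <= e / 2 by lra.
rewrite ltr_pdivlMr in uu'; last by lra.
have := nm_ge0 (u - u'); nra.
Qed.

Lemma closed_span0 x : closed_span x 0.
Proof. by rewrite -(@psum_eq0 x (fun=> 0) 0); [exact: closed_span_psum|]. Qed.

Lemma closed_spanB x u v : closed_span x u -> closed_span x v ->
  closed_span x (u - v).
Proof. by move=> Vu Vv; rewrite addrC -scaleN1r; exact: closed_span_lin. Qed.

Lemma closed_spanZ x c v : closed_span x v -> closed_span x (c *: v).
Proof.
by move=> Vv; rewrite -[_ *: _]addr0; exact/closed_span_lin/closed_span0.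
Qed.

Lemma closed_span_sum x (u : nat -> X) a n : (forall i, closed_span x (u i)) ->
  closed_span x (psum u a n).
Proof.
move=> Vu; elim: n => [|n IH].
  by rewrite /psum big_ord0; exact: closed_span0.
by rewrite psumS addrC; exact: closed_span_lin.
Qed.

Lemma supported_closed_span x p q v : supported x p q v -> closed_span x v.
Proof. by move=> [a _ ->]; exact: closed_span_psum. Qed.

Lemma closed_span_lim x (u : nat -> X) v :
  (forall n, closed_span x (u n)) -> u @ \oo --> v -> closed_span x v.
Proof.
move=> hu /cvg_nmP uv; apply/closure_nmP => e e0.
have [m /(_ _ (leqnn m)) um] := uv (e / 2) ltac:(lra).
have /closure_nmP/(_ (e / 2) ltac:(lra))[w sw uw] := hu m.
by exists w => //; have := nm_tri v (u m) w; lra.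
Qed.

Lemma basic_sequenceE x : basic_sequence x <->
  forall v, closed_span x v -> exists! a, psum x a @ \oo --> v.
Proof.
by split=> h v /h [a [av aU]]; exists a; (split=> [|b]; last move: (aU b));
  rewrite ?series_psum// in av *.
Qed.

Lemma basic_uniq x a b v : basic_sequence x ->
  psum x a @ \oo --> v -> psum x b @ \oo --> v -> a = b.
Proof.
move=> /basic_sequenceE xb av bv.
have /xb[c [_ cU]] : closed_span x v.
  by apply: closed_span_lim av => n; exact: closed_span_psum.
by rewrite -(cU a)// -(cU b).
Qed.

Lemma basic_neq0 x i : basic_sequence x -> x i != 0.
Proof.
move=> xb; apply/eqP => xi0.
have : (fun j => (j == i)%:R : K) = (fun=> 0).
  apply: (@basic_uniq x _ _ 0) => //; apply: (@cvg_stable _ 0%N) => n _.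
    rewrite /psum big1// => j _; case: eqP => [->|_]; last by rewrite scale0r.
    by rewrite xi0 scaler0.
  by rewrite psum_eq0.
by move=> /(congr1 (@^~ i)); rewrite eqxx => /eqP; rewrite oner_eq0.
Qed.

(** The partial sums of a finite sum are bounded by a multiple of the sum: this
    is the uniform boundedness of the projections on the linear span. *)
Definition basis_constant x (C : R) := 0 <= C /\
  forall a m n, (m <= n)%N -> nm (psum x a m) <= C * nm (psum x a n).

Lemma basis_constant_head x C p q f g : basis_constant x C ->
  supported x 0 p f -> supported x p q g -> nm f <= C * nm (f + g).
Proof.
move=> [_ hC] [a a0 ->] /(supported_widen (leqnn p) (leq_maxl q p))[b b0 ->].
have pq := leq_maxr q p; set n := maxn q p in pq b0 *.
have := hC (fun i => a i + b i) p n pq; rewrite !psumD.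
rewrite (@psum_eq0 _ b p) => [|i ip]; last by rewrite b0// ip.
by rewrite addr0 (psum_stable _ pq) => // i ip; rewrite a0// ip orbT.
Qed.

Lemma basis_constant_coef x C a i n : basis_constant x C -> (i < n)%N ->
  nm (a i) * nm (x i) <= 2 * C * nm (psum x a n).
Proof.
move=> [C0 hC] ilt; rewrite -nmZ.
have -> : a i *: x i = psum x a i.+1 - psum x a i.
  by rewrite psumS addrAC subrr add0r.
have := hC a _ _ ilt; have := hC a i n (ltnW ilt).
have := nmB (psum x a i.+1) (psum x a i); lra.
Qed.

(** If sequences of coefficients have uniformly convergent partial sums, their
    coordinatewise limit has the expansion that one expects.  The terms [x i]
    are nonzero, so each coordinate is a Cauchy sequence of scalars. *)
Lemma psum_limit x (a : nat -> nat -> K) (r : nat -> R) (s : nat -> X) v :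
  (forall i, x i != 0) -> vanishing r ->
  (forall j n, nm (psum x (a j.+1) n - psum x (a j) n) <= r j - r j.+1) ->
  (forall j, psum x (a j) @ \oo --> s j) -> s @ \oo --> v ->
  exists2 b, psum x b @ \oo --> v
    & forall j n, nm (psum x b n - psum x (a j) n) <= r j.
Proof.
move=> x0 [rge0 r0] ar asv sv.
have xgt0 i : 0 < nm (x i) by rewrite nm_gt0.
have coef i : exists c : K, forall j, nm (c - a j i) * nm (x i) <= 4 * r j.
  have [|| b bP] := scalar_complete HK (u := a^~ i)
    (r := fun j => 2 * r j / nm (x i)).
  - move=> j; rewrite -mulrBl ler_pdivlMr// -[rho _]/(nm _) -nmZ scalerBl.
    have -> : a j.+1 i *: x i - a j i *: x i =
        (psum x (a j.+1) i.+1 - psum x (a j) i.+1)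
        - (psum x (a j.+1) i - psum x (a j) i).
      by rewrite !psumS [- (_ + _ *: _)]opprD addrACA [RHS]addrAC subrr add0r.
    apply: le_trans (nmB _ _) _; have := ar j i.+1; have := ar j i; lra.
  - split=> [j|e e0]; first by rewrite divr_ge0 ?mulr_ge0// ltW.
    have [|j rj] := r0 (e * nm (x i) / 2); first by rewrite divr_gt0 ?mulr_gt0.
    by exists j; rewrite ltr_pdivrMr//; lra.
  exists b => j; have := bP j; rewrite -[rho _]/(nm _) => bj.
  have := ler_wpM2r (ltW (xgt0 i)) bj; rewrite !mulrA.
  by rewrite divfK ?gt_eqF//; lra.
have [b bP] := choice coef.
have bn j n : nm (psum x b n - psum x (a j) n) <= r j.
  have [l al lr] := @telescoping_cvg (fun j => psum x (a j) n) r (ar^~ n)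
    (conj rge0 r0).
  suff -> : psum x b n = l by [].
  apply/eqP; rewrite -subr_eq0; apply/eqP/nm_small => e e0.
  have [|k rk] := r0 (e / (4 * n%:R + 1)).
    by rewrite divr_gt0// ltr_wpDl// mulr_ge0.
  rewrite ltr_pdivlMr in rk; last by rewrite ltr_wpDl// mulr_ge0.
  have := nm_tri (psum x b n) (psum x (a k) n) l.
  rewrite (nmBC (psum x (a k) n)); have := lr k.
  suff : nm (psum x b n - psum x (a k) n) <= n%:R * (4 * r k) by lra.
  rewrite -psumB; apply: le_trans (nm_sum _ _ _) _.
  rewrite [X in _ <= X](_ : _ = \sum_(i < n) (4 * r k)).
    by apply: ler_sum => i _; rewrite nmZ.
  by rewrite sumr_const card_ord mulr_natl.
exists b => //; apply/cvg_nmP => e e0.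
have [j0 rj0] := r0 (e / 4) ltac:(lra).
have rle p : r (j0 + p)%N <= r j0.
  elim: p => [|p IH]; first by rewrite addn0.
  rewrite addnS; have := ar (j0 + p)%N 0%N; rewrite /psum !big_ord0 subrr nmr0.
  lra.
have [j1 sj1] := (cvg_nmP _ _).1 sv (e / 4) ltac:(lra).
have := sj1 (j0 + j1)%N (leq_addl _ _); have := rle j1.
set j := (j0 + j1)%N => rj sj.
have [n0 hn] := (cvg_nmP _ _).1 (asv j) (e / 4) ltac:(lra).
exists n0 => n /hn an.
have := nm_tri v (s j) (psum x b n).
have := nm_tri (s j) (psum x (a j) n) (psum x b n).
by rewrite (nmBC (psum x (a j) n)); have := bn j n; lra.
Qed.

(** The criterion of Grunblum.  For a vector of the closed span, take a fast
    sequence of approximations in the span: by the bound on the projections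
    their expansions converge uniformly, and [psum_limit] applies. *)
Lemma basic_of_basis_constant x C :
  basis_constant x C -> (forall i, x i != 0) -> basic_sequence x.
Proof.
move=> xC x0; have [C0 hC] := xC; apply/basic_sequenceE => v /closure_nmP xv.
have xgt0 i : 0 < nm (x i) by rewrite nm_gt0.
have half_gt0 j : 0 < 2^-1 ^+ j :> R by rewrite exprn_gt0// invr_gt0.
have /choice[s sP] (j : nat) : exists w, lspan x w /\ nm (v - w) < 2^-1 ^+ j.
  by have [w] := xv _ (half_gt0 j); exists w.
have /choice[a aP] (j : nat) : exists a : nat -> K, exists N,
    forall n, (N <= n)%N -> psum x a n = s j.
  have /lspanP[q [a a0 ->]] := (sP j).1; exists a, q => n qn.
  by rewrite (psum_stable _ qn) => // i qi; rewrite a0 ?qi ?orbT.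
pose r (j : nat) := 4 * C * 2^-1 ^+ j.
have ss j : nm (s j.+1 - s j) <= 2 * 2^-1 ^+ j.
  have := nm_tri (s j.+1) v (s j); rewrite (nmBC (s j.+1) v).
  have := (sP j).2; have := (sP j.+1).2; rewrite exprS.
  by have := half_gt0 j; lra.
have [||||b bv _] := @psum_limit x a r s v x0.
- split=> [j|e]; last exact: geometric_lt.
  by rewrite !mulr_ge0// ltW.
- move=> j n; have [N aN] := aP j; have [M aM] := aP j.+1.
  pose m := maxn n (maxn N M).
  have [le_nm Nm Mm] : [/\ n <= m, N <= m & M <= m]%N.
    by rewrite /m !leq_max !leqnn !orbT.
  have := hC (fun i => a j.+1 i - a j i) n m le_nm.
  rewrite !psumB (aN m Nm) (aM m Mm) => h; apply: le_trans h _.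
  have := ler_wpM2l C0 (ss j); rewrite /r exprS; lra.
- by move=> j; have [N aN] := aP j; exact: cvg_stable aN.
- apply/cvg_nmP => e /(geometric_lt 1)[n0]; rewrite mul1r => hn0.
  exists n0 => n nn; apply: lt_le_trans (sP n).2 _; apply: le_trans (ltW hn0).
  by apply: ler_wiXn2l => //; rewrite ?invr_ge0// invf_le1// ler1n.
exists b; split=> // c cv; apply/funext => i; apply/eqP.
rewrite -subr_eq0 -nm_eq0 -(mulIr_eq0 _ (mulIf (lt0r_neq0 (xgt0 i)))).
rewrite eq_le mulr_ge0 ?nm_ge0// andbT; apply/ler_addgt0Pr => e e0.
rewrite add0r.
have e2 : 0 < e / (4 * C + 1) by rewrite divr_gt0//; lra.
have [n1 h1] := (cvg_nmP _ _).1 bv _ e2.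
have [n2 h2] := (cvg_nmP _ _).1 cv _ e2.
pose n := maxn i.+1 (maxn n1 n2).
have /h1 bn : (n1 <= n)%N by rewrite /n !leq_max leqnn orbT.
have /h2 cn : (n2 <= n)%N by rewrite /n !leq_max leqnn !orbT.
have ilt : (i < n)%N by rewrite /n leq_max leqnn.
have := @basis_constant_coef x C (fun i => b i - c i) i n xC ilt.
rewrite psumB; have := nm_tri (psum x b n) v (psum x c n).
rewrite (nmBC (psum x b n) v); rewrite !ltr_pdivlMr in bn cn; [|lra..].
have := nm_ge0 (v - psum x b n); have := nm_ge0 (v - psum x c n).
nra.
Qed.

(** * The basis constant of a basic sequence *)

Lemma cvg_nm_bounded (u : nat -> X) (l : X) : u @ \oo --> l ->
  exists k : nat, forall n, nm (u n) <= k%:R.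
Proof.
move=> /cvg_nmP/(_ 1 ltr01)[m hm].
pose B := 1 + nm l + \sum_(i < m) nm (u i).
have uB n : nm (u n) <= B.
  have s0 : 0 <= \sum_(i < m) nm (u i) by apply: sumr_ge0 => i _; exact: nm_ge0.
  have [mn|lt_nm] := leqP m n.
    have := nm_tri (u n) l 0; rewrite !subr0 nmBC /B; have := hm n mn; lra.
  rewrite /B (bigD1 (Ordinal lt_nm))//= in s0 *.
  have : 0 <= \sum_(i < m | i != Ordinal lt_nm) nm (u i).
    by apply: sumr_ge0 => i _; exact: nm_ge0.
  have := nm_ge0 l; lra.
exists (Num.truncn B).+1 => n; apply: le_trans (uB n) _.
exact/ltW/truncnS_gt.
Qed.

(** The category theorem of Baire, relative to a closed set [V]: otherwise each
    ball centred in [V] contains a smaller one, also centred in [V], that stays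
    away from [G k], and the limit of nested balls of this kind, one for each
    [k], is in no [G k]. *)
Lemma baire_cover (V : set X) (G : nat -> set X) v1 :
  closed V -> V v1 -> (forall v, V v -> exists k, G k v) ->
  exists k v0 (r : R), [/\ 0 < r, V v0 &
    forall v, V v -> nm (v - v0) < r -> closure (G k) v].
Proof.
move=> cV Vv1 VG; apply: contrapT => h.
have step (kp : nat * (X * R)) : exists q : X * R,
    0 < kp.2.2 -> V kp.2.1 -> [/\ V q.1, 0 < q.2, q.2 <= kp.2.2 / 2,
      nm (q.1 - kp.2.1) <= kp.2.2 / 2 &
      forall u, G kp.1 u -> 2 * q.2 <= nm (q.1 - u)].
  case: kp => k [v r] /=; have [r0|] := ltP 0 r; last by exists (v, r).
  have [Vv|nV] := pselect (V v); last by exists (v, r).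
  have [w [Vw wv]] : exists w, [/\ V w, nm (w - v) < r / 2 & ~ closure (G k) w].
    apply: contrapT => hw; apply: h; exists k, v, (r / 2).
    split=> //; first lra.
    by move=> w Vw wv; apply: contrapT => nG; apply: hw; exists w.
  have [[e e0 he] _|nh] := pselect (exists2 e : R, 0 < e &
      forall u, G k u -> e <= nm (w - u)); last first.
    case; apply/closure_nmP => e e0; apply: contrapT => hu; apply: nh.
    exists e => // u Gu; rewrite leNgt; apply/negP => wu; apply: hu.
    by exists u.
  exists (w, Num.min (r / 2) (e / 2)) => /= _ _.
  rewrite lt_min !divr_gt0// ge_min lexx (ltW wv); split=> // u /he.
  have : Num.min (r / 2) (e / 2) <= e / 2 by rewrite ge_min lexx orbT.
  lra.
have [F FP] := choice step.
pose fix st n := if n is n'.+1 then F (n', st n') else (v1, 1).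
have inv n : V (st n).1 /\ 0 < (st n).2.
  by elim: n => [//|n [IV I0]]; have [] := FP (n, st n) I0 IV.
have stP n := FP (n, st n) (inv n).2 (inv n).1.
have rS n : (st n.+1).2 <= (st n).2 / 2 by have [] := stP n.
have [||w uw wr] := @telescoping_cvg (fun n => (st n).1) (fun n => (st n).2).
- by move=> n; have [_ _ ? + _] := stP n; have := rS n; lra.
- split=> [n|e /(geometric_lt 1)[n]]; first exact/ltW/(inv n).2.
  rewrite mul1r => hn; exists n; apply: le_lt_trans hn.
  elim: n => [|n IH]; first by rewrite expr0.
  by rewrite exprS; have := rS n; lra.
have Vw : V w.
  apply: cV; apply/closure_nmP => e.
  move=> /((cvg_nmP _ _).1 uw)[n /(_ n (leqnn n)) hn].
  by exists (st n).1 => //; exact: (inv n).1.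
have [k Gk] := VG w Vw.
have [_ r0 _ _ /(_ w Gk)] := stP k.
by have := wr k.+1; rewrite nmBC; lra.
Qed.

Definition bounded_expansion x (k : R) : set X := [set v |
  exists2 a, psum x a @ \oo --> v & forall n, nm (psum x a n) <= k].

(** The open mapping argument: by [baire_cover], the vectors whose
    partial sums are bounded by some [k] are dense in a ball of the closed
    span; translating and rescaling that ball makes [k] proportional to the
    norm of the vector that is approximated. *)
Lemma bounded_expansion_dense x : basic_sequence x -> exists2 M, 0 < M &
  forall v, closed_span x v -> forall e : R, 0 < e ->
    exists2 u, bounded_expansion x (M * nm v) u & nm (v - u) < e.
Proof.
move=> xb.
have [|||k [v0 [r [r0 Vv0 hv]]]] := @baire_cover (closed_span x)
    (fun k => bounded_expansion x k%:R) 0.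
- exact: closed_closure.
- by rewrite -(@psum_eq0 x (fun=> 0) 0); [exact: closed_span_psum|].
- move=> v /((basic_sequenceE x).1 xb)[a [av _]].
  by have [k ak] := cvg_nm_bounded av; exists k, a.
have k0 : 0 <= k%:R :> R by [].
(* The summand 1 only serves to make the constant positive. *)
exists (4 * k%:R / r + 1); first by rewrite ltr_wpDl// divr_ge0 ?mulr_ge0// ltW.
move=> v Vv e e0; have [->|vn0] := eqVneq v 0.
  exists 0; last by rewrite subrr nmr0.
  exists (fun=> 0).
    by apply: (@cvg_stable _ 0%N) => n _; rewrite psum_eq0.
  by move=> n; rewrite psum_eq0// nmr0 mulr0.
have vgt0 : 0 < nm v by rewrite nm_gt0.
(* The translate of [v0] by [t *: v] lies halfway to the border of the ball. *)
pose t := r / (2 * nm v).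
have t0 : 0 < t by rewrite divr_gt0// mulr_gt0.
have nmt : nm (iota t) = t by rewrite nm_iota gtr0_norm.
have tv : t * nm v = r / 2 by rewrite /t; field; rewrite gt_eqF.
have et : 0 < e * t / 2 by rewrite !divr_gt0// mulr_gt0.
have /(hv _ (closed_span_lin Vv Vv0))/closure_nmP/(_ _ et) :
    nm (iota t *: v + v0 - v0) < r.
  by rewrite addrK nmZ nmt tv; lra.
move=> [u1 [a1 a1u a1k] vu1].
have /(hv _ Vv0)/closure_nmP/(_ _ et)[u2 [a2 a2u a2k] vu2] : nm (v0 - v0) < r.
  by rewrite subrr nmr0.
have nmti : nm (iota t)^-1 = t^-1.
  by rewrite -fmorphV nm_iota gtr0_norm// invr_gt0.
exists ((iota t)^-1 *: (u1 - u2)).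
  exists (fun i => (iota t)^-1 * (a1 i - a2 i)).
    rewrite (_ : psum _ _ =
      fun n => (iota t)^-1 *: (psum x a1 n - psum x a2 n)).
      by apply: cvgZr; exact: cvgB.
    by apply/funext => n; rewrite psumZ psumB.
  move=> n; rewrite psumZ psumB nmZ nmti -(ler_pM2l t0) mulVKf ?gt_eqF//.
  have := nmB (psum x a1 n) (psum x a2 n); have := a1k n; have := a2k n.
  suff : t * ((4 * k%:R / r + 1) * nm v) = 2 * k%:R + r / 2 by lra.
  by rewrite mulrCA tv; field; rewrite gt_eqF.
rewrite -[v in nm (v - _)](scalerK (_ : iota t != 0)); last first.
  by rewrite fmorph_eq0 gt_eqF.
rewrite -scalerBr nmZ nmti -(ltr_pM2l t0) mulVKf ?gt_eqF//.
have -> : iota t *: v - (u1 - u2) = (iota t *: v + v0 - u1) - (v0 - u2).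
  rewrite !opprB [_ + v0 - u1]addrAC -[RHS]addrA [v0 + _]addrC subrK.
  by rewrite addrA addrAC.
by have := nmB (iota t *: v + v0 - u1) (v0 - u2); lra.
Qed.

(** Iterating the previous approximation, a vector of the closed span has an
    expansion whose partial sums are bounded by a multiple of its norm; since
    expansions are unique, this bounds the partial sum projections. *)
Lemma basic_projections_bounded x : basic_sequence x -> exists2 M, 0 < M &
  forall a v, psum x a @ \oo --> v -> forall n, nm (psum x a n) <= M * nm v.
Proof.
move=> xb; have [M M0 hM] := bounded_expansion_dense xb.
exists (2 * M) => [|a v av n]; first by rewrite mulr_gt0.
suff bound c : 0 < c -> nm v <= c -> nm (psum x a n) <= 2 * M * c.
  apply/ler_addgt0Pr => e e0.
  have e2 : 0 < e / (2 * M) by rewrite divr_gt0// mulr_gt0.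
  have := bound (nm v + e / (2 * M)).
  rewrite mulrDr mulrCA divff ?gt_eqF ?mulr_gt0// mulr1.
  by apply; [rewrite ltr_wpDl// nm_ge0|rewrite lerDl ltW].
move=> c0 vc.
have Vv : closed_span x v.
  by apply: closed_span_lim av => m; exact: closed_span_psum.
have h0 j : 0 < c * 2^-1 ^+ j by rewrite mulr_gt0// exprn_gt0// invr_gt0.
have step (jw : nat * X) : exists bu : (nat -> K) * X,
    closed_span x jw.2 -> nm jw.2 <= c * 2^-1 ^+ jw.1 ->
    [/\ psum x bu.1 @ \oo --> bu.2,
      forall m, nm (psum x bu.1 m) <= M * (c * 2^-1 ^+ jw.1) &
      nm (jw.2 - bu.2) <= c * 2^-1 ^+ jw.1.+1].
  case: jw => j w /=.
  have [Vw|nV] := pselect (closed_span x w); last by exists (fun=> 0, 0).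
  have [u [b bu bM] wu] := hM w Vw _ (h0 j.+1).
  exists (b, u) => _ wc; split=> //= [m|]; last exact: ltW.
  by apply: le_trans (bM m) _; rewrite ler_pM2l.
have [F FP] := choice step.
(* [rem j] is what remains of [v] after [j] approximations, and [A j] collects
   the coefficients of these approximations. *)
pose fix rem j := if j is i.+1 then rem i - (F (i, rem i)).2 else v : X.
pose A j m := \sum_(i < j) (F (val i, rem (val i))).1 m.
have inv j : closed_span x (rem j) /\ nm (rem j) <= c * 2^-1 ^+ j.
  elim: j => [|j [Vr rc]]; first by rewrite expr0 mulr1.
  have [bu _ wu] := FP (j, rem j) Vr rc; split=> //=.
  rewrite addrC -scaleN1r; apply: closed_span_lin => //.
  by apply: closed_span_lim bu => m; exact: closed_span_psum.
have FjP j := FP (j, rem j) (inv j).1 (inv j).2.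
have psumA j : psum x (A j.+1) =
    (fun m => psum x (A j) m + psum x (F (j, rem j)).1 m).
  apply/funext => m; rewrite -psumD; congr (psum x _ m); apply/funext => i.
  by rewrite /A big_ord_recr.
have [|||||b bv bA] := @psum_limit x A (fun j => 2 * M * c * 2^-1 ^+ j)
    (fun j => v - rem j) v.
- by move=> i; exact: basic_neq0.
- split=> [j|e]; last exact: geometric_lt.
  by rewrite -mulrA mulr_ge0// ?ltW// mulr_gt0.
- move=> j m; rewrite psumA addrAC subrr add0r.
  by have [_ /(_ m) + _] := FjP j; rewrite /= exprS; lra.
- elim=> [|j IH].
    apply: (@cvg_stable _ 0%N) => m _; rewrite /= subrr psum_eq0// => i _.
    by rewrite /A big_ord0.
  rewrite psumA [v - _](_ : _ = v - rem j + (F (j, rem j)).2).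
    apply: cvgD => //.
    by have [] := FjP j.
  by rewrite /= opprB addrCA addrC.
- apply/cvg_nmP => e /(geometric_lt c)[j0 hj0]; exists j0 => j jj.
  rewrite opprB addrC subrK; apply: le_lt_trans (inv j).2 _.
  apply: le_lt_trans hj0; rewrite ler_pM2l//.
  by apply: ler_wiXn2l => //; rewrite ?invr_ge0// invf_le1// ler1n.
have := bA 0%N n; rewrite (basic_uniq xb av bv) (@psum_eq0 _ (A 0%N)).
  by rewrite subr0 expr0 mulr1.
by move=> i _; rewrite /A big_ord0.
Qed.

Lemma basis_constant_of_basic x : basic_sequence x ->
  exists C, basis_constant x C.
Proof.
move=> /basic_projections_bounded[M M0 hM]; exists M; split; first exact: ltW.
move=> a m n mn; pose b i := if (i < n)%N then a i else 0.
have bE k : (k <= n)%N -> psum x b k = psum x a k.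
  by move=> kn; apply: eq_bigr => i _; rewrite /b (leq_trans (ltn_ord i)).
rewrite -(bE m mn) -(bE n (leqnn n)); apply: hM.
apply: (@cvg_stable _ n) => k nk; apply: psum_stable => // i ni.
by rewrite /b ltnNge ni.
Qed.

(** * Block sequences *)

(** A partial sum of blocks is a head of the whole sum with respect to [x], so
    the basis constant is inherited. *)
Lemma block_basis_constant x C (u : nat -> X) (p : nat -> nat) :
  basis_constant x C -> (forall j, (p j <= p j.+1)%N) ->
  (forall j, supported x (p j) (p j.+1) (u j)) -> basis_constant u C.
Proof.
move=> xC pS up; split=> [|a m n mn]; first exact: xC.1.
have pD m' n' : (m' <= n')%N -> (p m' <= p n')%N.
  move=> /subnKC <-; elim: (n' - m')%N => [|k IH]; first by rewrite addn0.
  by rewrite addnS (leq_trans IH).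
have sum_supp m' n' : (m' <= n')%N ->
    supported x (p m') (p n') (\sum_(m' <= i < n') a i *: u i).
  move=> mn'; rewrite big_nat; elim/big_ind : _ => [|f g|i /andP[mi ilt]].
  - exact: supported0.
  - exact: supportedD.
  - by apply/supportedZ/supported_widen/up; exact: pD.
rewrite (psum_split _ _ mn); apply: (basis_constant_head xC _ (sum_supp _ _ mn)).
rewrite /psum -(big_mkord predT (fun i => a i *: u i)).
exact: supported_widen (sum_supp 0%N m (leq0n m)).
Qed.

(** Diagonal extraction of a block sequence: if the [j]-th of countably many
    sequences is eventually supported beyond any given index, then one term can
    be picked from each so that the supports are successive. *)
Lemma block_extraction x C (t : nat -> nat -> X) : basis_constant x C ->
  (forall j n, exists q, supported x n q (t j n)) ->
  (forall j n, t j n != 0) ->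
  exists h, increasing_seq h /\ basic_sequence (fun j => t j (h j)).
Proof.
move=> xC tq t0; have [q qP] := choice (fun jn => tq jn.1 jn.2).
pose fix h j := if j is i.+1 then maxn (h i).+1 (q (i, h i)) else 0%N.
have hS j : (h j < h j.+1)%N by rewrite /= leq_maxl.
exists h; split; first exact/increasing_seqP.
apply: (@basic_of_basis_constant _ C) => [|i]; last exact: t0.
apply: (block_basis_constant (p := h) xC) => j; first exact/ltnW/hS.
by apply: supported_widen (qP (j, h j)); rewrite //= leq_maxr.
Qed.

(** * Operators on the closed span *)

Section Operator.
Context {x : nat -> X} {S : X -> X}.
Context (Sop : bounded_operator_on (closed_span x) S).

Lemma op_bound : exists2 L, 0 <= L &
  forall v, closed_span x v -> nm (S v) <= L * nm v.
Proof.
have [_ [c hc]] := Sop; exists (nm c); first exact: nm_ge0.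
by move=> v /hc/nm_le_mul.
Qed.

Lemma op0 : S 0 = 0.
Proof.
have V0 := closed_span0 x; have := Sop.1 1 0 0 V0 V0.
by rewrite !scale1r addr0 => h; apply: (addrI (S 0)); rewrite addr0 -h.
Qed.

Lemma opZ c v : closed_span x v -> S (c *: v) = c *: S v.
Proof.
by move=> Vv; have := Sop.1 c _ _ Vv (closed_span0 x); rewrite op0 !addr0.
Qed.

Lemma opD u v : closed_span x u -> closed_span x v -> S (u + v) = S u + S v.
Proof. by move=> Vu Vv; have := Sop.1 1 _ _ Vu Vv; rewrite !scale1r. Qed.

Lemma opB u v : closed_span x u -> closed_span x v -> S (u - v) = S u - S v.
Proof.
move=> Vu Vv; have := Sop.1 (-1) _ _ Vv Vu.
by rewrite !scaleN1r addrC [RHS]addrC.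
Qed.

Lemma op_psum (u : nat -> X) a n : (forall i, closed_span x (u i)) ->
  S (psum u a n) = psum (S \o u) a n.
Proof.
move=> Vu; elim: n => [|n IH]; first by rewrite /psum !big_ord0 op0.
by rewrite !psumS addrC Sop.1 ?IH 1?addrC//; exact: closed_span_sum.
Qed.

Lemma op_dominates (u : nat -> X) : (forall i, closed_span x (u i)) ->
  dominates u (S \o u).
Proof.
move=> Vu; have [L L0 hL] := op_bound; exists (iota L) => N a.
rewrite -[X in `|X| <= _]/(psum (S \o u) a N) -op_psum//.
rewrite -!iota_nm -rmorphM (iota_le HK); exact/hL/closed_span_sum.
Qed.

End Operator.

(** Total boundedness of bounded sets in finite dimension, in coordinates: the
    nets of the scalars are combined coordinate by coordinate. *)
Lemma psum_net (y : nat -> X) n (B e : R) : 0 < e -> exists D : seq X,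
  forall a, (forall i, (i < n)%N -> nm (a i) <= B) ->
  exists2 d, d \in D & nm (psum y a n - d) < e.
Proof.
elim: n e => [|n IH] e e0.
  by exists [:: 0] => a _; exists 0; rewrite ?mem_head// psum_eq0// subrr nmr0.
have [D hD] := IH (e / 2) ltac:(lra).
have yn : 0 < nm (y n) + 1 by have := nm_ge0 (y n); lra.
have e'0 : 0 < e / 2 / (nm (y n) + 1) by rewrite !divr_gt0.
have [s hs] := scalar_net HK B e'0.
exists [seq d + c *: y n | d <- D, c <- s] => a aB.
have [|d dD ad] := hD a; first by move=> i /ltnW; exact: aB.
have [b bs] := hs (a n) (aB n (leqnn _)).
rewrite -[rho _]/(nm _) ler_pdivlMr// => ab.
exists (d + b *: y n); first by apply/allpairsP; exists (d, b).
rewrite psumS opprD addrACA -scalerBl; apply: le_lt_trans (nmD _ _) _.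
by rewrite nmZ; have := nm_ge0 (a n - b); lra.
Qed.

(** A bounded operator that is not compact is uniformly far from compact on all
    tails: the heads range over bounded sets of a finite-dimensional space, so a
    finite net for the image of the unit ball of one tail would give a finite
    net for the image of the whole unit ball. *)
Lemma noncompact_on_tails x C S : basis_constant x C -> (forall i, x i != 0) ->
  bounded_operator_on (closed_span x) S ->
  ~ compact_operator_on (closed_span x) S ->
  exists2 delta : R, 0 < delta & forall n (D : seq X), exists u,
    [/\ exists q, supported x n q u, nm u <= 1
      & forall d, d \in D -> delta <= nm (S u - d)].
Proof.
move=> xC x0 Sop ncS; have [C0 _] := xC; have [L L0 SL] := op_bound Sop.
have [e e0 he] : exists2 e : R, 0 < e & ~ exists D : seq X,
    forall v, closed_span x v -> nm v <= 1 ->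
    exists2 d, d \in D & nm (S v - d) < e.
  apply: contrapT => h; apply: ncS; split=> //.
  apply: precompact_of_totally_bounded => e e0; apply: contrapT => hD; apply: h.
  exists e => // -[D hD']; apply: hD; exists D => _ [v [Vv v1] <-].
  apply: hD' => //.
  by rewrite -(iota_le HK) iota_nm rmorph1.
(* [P] bounds the tails of the vectors of norm at most 2 in the span. *)
pose P := 2 * (1 + C); have P0 : 0 < P by rewrite /P; lra.
exists (e / 4 / P) => [|n D]; first by rewrite !divr_gt0.
apply: contrapT => nu; apply: he.
have net g q : supported x n q g -> nm g <= P ->
    exists2 d, d \in D & nm (S g - iota P *: d) < e / 4.
  move=> gq gP; apply: contrapT => hd; apply: nu; exists ((iota P)^-1 *: g).
  have nP : nm (iota P)^-1 = P^-1.
    by rewrite -fmorphV nm_iota gtr0_norm// invr_gt0.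
  split=> [||d dD]; first by exists q; exact: supportedZ.
    by rewrite nmZ nP mulrC ler_pdivrMr// mul1r.
  rewrite leNgt; apply/negP => Sgd; apply: hd; exists d => //.
  rewrite (opZ Sop) in Sgd; last exact: supported_closed_span gq.
  rewrite -[S g](scalerKV (_ : iota P != 0)) ?fmorph_eq0 ?gt_eqF//.
  by rewrite -scalerBr nmZ nm_iota gtr0_norm// mulrC -ltr_pdivlMr.
pose B := \sum_(i < n) (4 * C / nm (x i)).
have [D' hD'] := psum_net (S \o x) n B (divr_gt0 e0 (ltr0Sn R 3)).
exists [seq d' + iota P *: d | d' <- D', d <- D] => v Vv v1.
have [|w /lspanP[q0 wq0] vw] :=
    (closure_nmP _ _).1 Vv (Num.min 1 (e / 4 / (L + 1))).
  by rewrite lt_min ltr01 !divr_gt0//; lra.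
move: vw; rewrite lt_min => /andP[vw1 vw]; rewrite ltr_pdivlMr in vw; last lra.
have wq := supported_widen (leqnn 0) (leq_maxl q0 n) wq0.
have nq := leq_maxr q0 n; set q := maxn q0 n in wq nq.
have [a [g [gq wE waE]]] := supported_split nq wq.
have w2 : nm w <= 2 by have := nm_tri w v 0; rewrite !subr0 nmBC; lra.
have fP : nm (psum x a n) <= C * nm w.
  by rewrite wE; apply: basis_constant_head xC _ gq; exact: supported_psum.
have Cw : C * nm w <= C * 2 by exact: ler_wpM2l.
have [|d dD Sgd] := net g q gq.
  have -> : g = w - psum x a n by rewrite wE addrAC subrr add0r.
  by have := nmB w (psum x a n); rewrite /P; lra.
have [|d' d'D Sfd] := hD' a.
  move=> i ilt; have xi : 0 < nm (x i) by rewrite nm_gt0.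
  have : nm (a i) <= 4 * C / nm (x i).
    rewrite ler_pdivlMr//.
    have := basis_constant_coef a xC (leq_trans ilt nq); rewrite -waE.
    by have := Cw; lra.
  move=> ai; apply: le_trans ai _; rewrite /B (bigD1 (Ordinal ilt))//= lerDl.
  by apply: sumr_ge0 => j _; rewrite divr_ge0 ?nm_ge0// mulr_ge0.
exists (d' + iota P *: d); first by apply/allpairsP; exists (d', d).
have Vf : closed_span x (psum x a n) by exact: closed_span_psum.
have Vg : closed_span x g by exact: supported_closed_span gq.
have Vw : closed_span x w by exact: supported_closed_span wq.
have Vx i : closed_span x (x i).
  by apply: supported_closed_span (supported_unit _ (leqnn i) (ltnSn i)).
have -> : S v - (d' + iota P *: d) =
    S (v - w) + ((psum (S \o x) a n - d') + (S g - iota P *: d)).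
  rewrite -(op_psum Sop)// addrACA -opprD -(opD Sop)// -wE (opB Sop)//.
  by rewrite addrA subrK.
have := nmD (S (v - w)) ((psum (S \o x) a n - d') + (S g - iota P *: d)).
have := nmD (psum (S \o x) a n - d') (S g - iota P *: d).
have := SL _ (closed_spanB Vv Vw); have := nm_ge0 (v - w).
move=> vw0 SLvw n1 n2; have : L * nm (v - w) <= e / 4 by nra.
lra.
Qed.

(** * From an operator to a dominated sequence *)

Lemma increasing_seq_ge (h : nat -> nat) n : increasing_seq h -> (n <= h n)%N.
Proof.
move=> /increasing_seqP hS; elim: n => // n IH.
exact: leq_ltn_trans IH (hS n).
Qed.

Lemma cvg_reindex (u : nat -> X) (g : nat -> nat) (l : X) :
  (forall n, (n <= g n)%N) -> u @ \oo --> l -> (fun n => u (g n)) @ \oo --> l.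
Proof.
move=> gn /cvg_nmP ul; apply/cvg_nmP => e /ul[m hm]; exists m => n mn.
by apply: hm; exact: leq_trans mn (gn n).
Qed.

Lemma seminormalized_nm (u : nat -> X) (c B : R) : 0 < c ->
  (forall n, c <= nm (u n) <= B) -> seminormalized u.
Proof.
move=> c0 h; exists (iota c), (iota B); rewrite iota_gt0; split=> // n.
by rewrite -iota_nm !(iota_le HK).
Qed.

(** See the explanation at the top: the sequences [x2], [u] and the interleaved
    sequence [fun j => t j (h2 j)] are examined in this order. *)
Lemma dominated_sequence_of_operator :
  has_nontrivial_operator X -> has_nontrivial_dominated_sequence X.
Proof.
move=> [x [T [xb Top nT]]].
have [C xC] := basis_constant_of_basic xb.
have x0 i := basic_neq0 i xb.
have Tu (u : nat -> X) (c B : R) : basic_sequence u -> 0 < c ->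
    (forall n, c <= nm (u n) <= B) -> (forall n, closed_span x (u n)) ->
    [\/ no_scalar_subsequence u (T \o u), scalar_limit_noncompact u (T \o u)
      | two_scalar_limits u (T \o u)] ->
    has_nontrivial_dominated_sequence X.
  move=> ub c0 ucB Vu h; exists u, (T \o u); split=> //.
  - exact: seminormalized_nm ucB.
  - exact: (op_dominates Top).
have Vx i : closed_span x (x i).
  by apply: supported_closed_span (supported_unit _ (leqnn i) (ltnSn i)).
pose x1 n := (iota (nm (x n)))^-1 *: x n.
have x11 n : nm (x1 n) = 1.
  rewrite nmZ -fmorphV nm_iota ger0_norm ?invr_ge0 ?nm_ge0// mulVf//.
  by rewrite nm_eq0.
have sx1 n : supported x n n.+1 (x1 n) by apply/supportedZ/supported_unit.
have [|j n|h0 [h0inc x2b]] := @block_extraction x C (fun=> x1) xC.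
- by move=> _ n; exists n.+1.
- by rewrite -nm_gt0 x11.
pose x2 j := x1 (h0 j).
have Vx2 n : closed_span x (x2 n) by exact: supported_closed_span (sx1 _).
have [h|] := pselect (no_scalar_subsequence x2 (T \o x2)).
  apply: (Tu x2 1 1) => //; last by constructor 1.
  by move=> n; rewrite x11 lexx.
move=> nh; have [l /contrapT[k [kinc xk]]] := (existsNP _).2 nh.
pose S v := T v - l *: v.
have Sop : bounded_operator_on (closed_span x) S.
  split=> [c u v Vu Vv|].
    rewrite /S Top.1// scalerDr scalerA [l * c]mulrC -scalerA opprD addrACA.
    by rewrite -scalerBr.
  have [L _ TL] := op_bound Top; exists (iota (L + nm l)) => v Vv.
  rewrite -!iota_nm -rmorphM (iota_le HK) /S mulrDl -nmZ.
  by apply: le_trans (nmB _ _) _; rewrite lerD2r TL.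
have [|delta d0 far] := noncompact_on_tails xC x0 Sop.
  move=> Sc; apply: nT; exists l, S; split=> // v _.
  by rewrite /S addrC subrK.
have [L L0 SL] := op_bound Sop.
have [F FP] := choice (fun nD => far nD.1 nD.2).
(* [D n] lists what [S (v n)] has to avoid: the images of the earlier [v i] and,
   to bound [v n] from below, zero. *)
pose fix D n := if n is m.+1 then S (F (m, D m)) :: D m else [:: 0].
pose v n := F (n, D n).
have [vsupp v1 vD] : [/\ forall n, exists q, supported x n q (v n),
    forall n, nm (v n) <= 1 &
    forall n d, d \in D n -> delta <= nm (S (v n) - d)].
  by split=> n; have [] := FP (n, D n).
have Vv n : closed_span x (v n).
  by have [q /supported_closed_span] := vsupp n.
have D0 n : 0 \in D n by elim: n => [|n IH]; rewrite inE ?eqxx// IH orbT.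
have Dv n i : (i < n)%N -> S (v i) \in D n.
  elim: n => // n IH; rewrite ltnS leq_eqVlt inE => /predU1P[->|/IH ->].
    by rewrite eqxx.
  by rewrite orbT.
have vlow n : delta / (L + 1) <= nm (v n).
  rewrite ler_pdivrMr; last lra.
  have := vD n 0 (D0 n); rewrite subr0; have := SL _ (Vv n).
  by have := nm_ge0 (v n); lra.
have dL0 : 0 < delta / (L + 1) by rewrite divr_gt0//; lra.
have [//|j n|h1 [h1inc ub]] := @block_extraction x C (fun=> v) xC.
  by rewrite -nm_gt0; exact: lt_le_trans (vlow n).
pose u j := v (h1 j).
have Vu n : closed_span x (u n) by exact: Vv.
have [h|] := pselect (no_scalar_subsequence u (T \o u)).
  apply: (Tu u (delta / (L + 1)) 1) => //; last by constructor 1.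
  by move=> n; rewrite vlow v1.
move=> nh2; have [m /contrapT[k1 [k1inc uk1]]] := (existsNP _).2 nh2.
have lm : l != m.
  apply/eqP => lm; move: uk1; rewrite -lm => /cvg_ex[w /cvg_nmP uw].
  have [i /(_ _ _)-hi] := uw (delta / 2) ltac:(lra).
  have := hi i (leqnn i); have := hi i.+1 (leqnSn i).
  have : delta <= nm (S (u (k1 i.+1)) - S (u (k1 i))).
    by apply/vD/Dv; move/increasing_seqP: h1inc => h1S;
      apply: (homo_ltn ltn_trans h1S); move/increasing_seqP: k1inc; exact.
  have := nm_tri (S (u (k1 i.+1))) w (S (u (k1 i))).
  by rewrite (nmBC (S (u (k1 i.+1))) w) /S /=; lra.
pose t j n := if odd j then u (k1 n) else x2 (k n).
have [|j n|h2 [h2inc zb]] := @block_extraction x C t xC.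
- move=> j n; rewrite /t; case: odd.
    have [q vq] := vsupp (h1 (k1 n)); exists q; apply: supported_widen vq => //.
    by apply: leq_trans (increasing_seq_ge _ h1inc); exact: increasing_seq_ge.
  exists (h0 (k n)).+1; apply: supported_widen (sx1 _) => //.
  by apply: leq_trans (increasing_seq_ge _ h0inc); exact: increasing_seq_ge.
- rewrite /t -nm_gt0; case: odd; last by rewrite x11.
  exact: lt_le_trans (vlow _).
pose c := Num.min (delta / (L + 1)) 1.
apply: (Tu (fun j => t j (h2 j)) c 1) => //.
- by rewrite lt_min dL0 ltr01.
- move=> n; rewrite /t /c ge_min; case: odd; last by rewrite x11 lexx orbT.
  by rewrite vlow v1.
- by move=> n; rewrite /t; case: odd.
have h2ge g : (forall n, (n <= g n)%N) -> forall n, (n <= h2 (g n))%N.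
  by move=> gn n; exact: leq_trans (gn n) (increasing_seq_ge _ h2inc).
constructor 3; exists l, m, double, (fun n => n.*2.+1); split=> //.
- by apply/increasing_seqP => n; rewrite doubleS ltEnat/= ltnS leqnSn.
- by apply/increasing_seqP => n; rewrite doubleS ltEnat/= !ltnS.
- move/cvg_ex: xk => [w xw]; apply/cvg_ex; exists w.
  rewrite (_ : (fun n => _) =
    (fun n => T (x2 (k (h2 n.*2))) - l *: x2 (k (h2 n.*2)))).
    apply: (@cvg_reindex (fun n => T (x2 (k n)) - l *: x2 (k n))) xw.
    by apply: h2ge => n; rewrite -addnn leq_addr.
  by apply/funext => n; rewrite /= /t odd_double.
- move/cvg_ex: uk1 => [w uw]; apply/cvg_ex; exists w.
  rewrite (_ : (fun n => _) =
    (fun n => T (u (k1 (h2 n.*2.+1))) - m *: u (k1 (h2 n.*2.+1)))).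
    apply: (@cvg_reindex (fun n => T (u (k1 n)) - m *: u (k1 n))) uw.
    by apply: h2ge => n; rewrite -addnn (leq_trans (leq_addr n n))// leqnSn.
  by apply/funext => n; rewrite /= /t /= odd_double.
Qed.

(** * From a dominated sequence to an operator *)

Lemma cvg_nm_le (u w : nat -> X) (l m : X) (L : R) :
  0 <= L -> u @ \oo --> l -> w @ \oo --> m ->
  (forall n, nm (u n) <= L * nm (w n)) -> nm l <= L * nm m.
Proof.
move=> L0 /cvg_nmP ul /cvg_nmP wm uw; apply/ler_addgt0Pr => e e0.
have e1 : 0 < e / (L + 1) by rewrite divr_gt0//; lra.
have [n1 h1] := ul _ e1; have [n2 h2] := wm _ e1.
have := h1 (n1 + n2)%N (leq_addr _ _); have := h2 (n1 + n2)%N (leq_addl _ _).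
have := uw (n1 + n2)%N; set n := (n1 + n2)%N.
rewrite !ltr_pdivlMr; [|lra..] => uwn mn ln.
have := nm_tri l (u n) 0; have := nm_tri (w n) m 0; rewrite !subr0 (nmBC (w n)).
have := nm_ge0 (m - w n); have := nm_ge0 (l - u n).
nra.
Qed.

(** The map [x i |-> y i] extends to expansions because the partial sums of
    the image series are dominated by those of a convergent one. *)
Lemma operator_of_dominates x (y : nat -> X) :
  basic_sequence x -> dominates x y ->
  exists2 T, bounded_operator_on (closed_span x) T &
    forall a n, T (psum x a n) = psum y a n.
Proof.
move=> xb [c hc].
have [L L0 hL] : exists2 L : R, 0 <= L &
    forall a n, nm (psum y a n) <= L * nm (psum x a n).
  exists (nm c) => [|a n]; first exact: nm_ge0.
  exact/nm_le_mul/hc.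
have ycvg a v : psum x a @ \oo --> v -> exists w : X, psum y a @ \oo --> w.
  move=> /cvg_nmP av; apply: cvg_nm_cauchy => e e0.
  have [|m hm] := av (e / 2 / (L + 1)); first by rewrite !divr_gt0//; lra.
  exists m => n mn.
  pose b i := if (i < m)%N then 0 else a i.
  have bE (z : nat -> X) : psum z a n - psum z a m = psum z b n.
    rewrite !(psum_split _ _ mn) addrAC subrr add0r psum_eq0 => [|i im].
      rewrite add0r !big_nat; apply: eq_bigr => i /andP[mi _].
      by rewrite /b ltnNge mi.
    by rewrite /b im.
  rewrite nmBC bE; apply: le_lt_trans (hL b n) _; rewrite -bE.
  have := nm_tri (psum x a n) v (psum x a m); rewrite (nmBC (psum x a n) v).
  have := hm n mn; have := hm m (leqnn m); rewrite !ltr_pdivlMr; [|lra..].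
  by have := nm_ge0 (psum x a n - psum x a m); nra.
have ex v : exists w : X, closed_span x v ->
    exists2 a, psum x a @ \oo --> v & psum y a @ \oo --> w.
  have [|nV] := pselect (closed_span x v); last by exists 0.
  move=> /((basic_sequenceE x).1 xb)[a [av _]].
  by have [w aw] := ycvg a v av; exists w => _; exists a.
have [T TP] := choice ex.
have TE a v w : psum x a @ \oo --> v -> psum y a @ \oo --> w -> T v = w.
  move=> av aw; have [|b bv bT] := TP v.
    by apply: closed_span_lim av => n; exact: closed_span_psum.
  by rewrite (basic_uniq xb bv av) in bT; exact: cvg_unique bT aw.
exists T; first split.
- move=> k u v /TP[a au aT] /TP[b bv bT].
  have lin (z : nat -> X) : psum z (fun i => k * a i + b i) =
      (fun n => k *: psum z a n + psum z b n).
    by apply/funext => n; rewrite psumD psumZ.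
  apply: (TE (fun i => k * a i + b i)); rewrite lin;
    by apply: cvgD => //; exact: cvgZr.
- exists (iota L) => v /TP[a av aT]; rewrite -!iota_nm -rmorphM (iota_le HK).
  by apply: cvg_nm_le aT av _ => // n; exact: hL.
- move=> a n; pose b i := if (i < n)%N then a i else 0.
  have bE (z : nat -> X) : psum z b @ \oo --> psum z a n.
    rewrite (_ : psum z a n = psum z b n); last first.
      by apply: eq_bigr => i _; rewrite /b ltn_ord.
    apply: (@cvg_stable _ n) => m le_nm; apply: psum_stable => // i ni.
    by rewrite /b ltnNge ni.
  exact: TE (bE x) (bE y).
Qed.

Lemma compact_operator_subsequence (V : set X) S (z : nat -> X) (B : R) :
  (forall c v, V v -> V (c *: v)) ->
  (forall c v, V v -> S (c *: v) = c *: S v) ->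
  compact_operator_on V S -> (forall n, V (z n)) -> (forall n, nm (z n) <= B) ->
  has_converging_subsequence (S \o z).
Proof.
move=> VZ SZ [_ Spre] Vz zB; pose d := iota (B + 1).
have B1 : 0 < B + 1 by have := nm_ge0 (z 0%N); have := zB 0%N; lra.
have dn0 : d != 0 by rewrite fmorph_eq0 gt_eqF.
have [|k [kinc /cvg_ex[l kl]]] :=
    precompact_subsequence (u := fun n => S (d^-1 *: z n)) Spre.
  move=> n; exists (d^-1 *: z n) => //=; split; first exact: VZ.
  rewrite -(rmorph1 iota) nm_le nmZ -fmorphV nm_iota gtr0_norm ?invr_gt0//.
  by rewrite mulrC ler_pdivrMr// mul1r; have := zB n; lra.
exists k; split=> //; apply/cvg_ex; exists (d *: l).
rewrite (_ : _ \o _ = fun n => d *: S (d^-1 *: z (k n))); first exact: cvgZr.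
by apply/funext => n /=; rewrite -SZ ?scalerKV//; exact: VZ.
Qed.

(** The basis constant bounds [x (k m)] by a multiple of its distance to
    [x (k m.+1)], so these distances do not tend to zero. *)
Lemma basic_no_cvg_subsequence x C (c : R) (k : nat -> nat) s :
  basis_constant x C -> 0 < c -> (forall n, c <= nm (x n)) ->
  increasing_seq k -> cvgn (fun n => s *: x (k n)) -> s = 0.
Proof.
move=> xC c0 xc /increasing_seqP kS /cvg_ex[l /cvg_nmP sl].
have C0 := xC.1.
apply/nm_small => e e0.
have [|m hm] := sl (e * c / 2 / (C + 1)).
  by rewrite !divr_gt0 ?mulr_gt0//; lra.
have := hm m (leqnn m); have := hm m.+1 (leqnSn m).
set d := _ / (C + 1) => h1 h0.
have : nm (s *: x (k m)) <= C * nm (s *: x (k m) + (- s) *: x (k m.+1)).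
  apply: (basis_constant_head (p := (k m).+1) (q := (k m.+1).+1) xC).
    exact/supportedZ/supported_unit.
  by apply/supportedZ/supported_unit => //; exact: kS.
rewrite scaleNr; have := nm_tri (s *: x (k m)) l (s *: x (k m.+1)).
rewrite (nmBC (s *: x (k m)) l) nmZ => h2 h3.
have dC : d * (C + 1) = e * c / 2 by rewrite /d divfK ?gt_eqF//; lra.
have h4 : C * nm (s *: x (k m) - s *: x (k m.+1)) <= C * (2 * d).
  by apply: ler_wpM2l => //; lra.
have d0 : 0 <= d by have := nm_ge0 (l - s *: x (k m)); lra.
rewrite -(ler_pM2r c0); have := ler_wpM2l (nm_ge0 s) (xc (k m)); lra.
Qed.

Lemma bounded_fun_nm (z : nat -> X) : bounded_fun z ->
  exists B : R, forall n, nm (z n) <= B.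
Proof.
move=> [M [Mr hM]]; exists (nm (M + 1)) => n.
by apply: nm_le_nm; apply: hM; rewrite ?ltrDl.
Qed.

Lemma seminormalized_bounds (u : nat -> X) : seminormalized u ->
  exists c B : R, 0 < c /\ forall n, c <= nm (u n) <= B.
Proof.
move=> [_ [D [/iota_gt0P[c c0 ->] h]]]; exists c, (nm D); split=> // n.
have /andP[cu /nm_le_nm ->] := h n.
by rewrite andbT -(iota_le HK) iota_nm.
Qed.

Lemma operator_of_dominated_sequence :
  has_nontrivial_dominated_sequence X -> has_nontrivial_operator X.
Proof.
move=> [x [y [xb xs xy hxy]]].
have [T Top Txy] := operator_of_dominates xb xy.
exists x, T; split=> // -[l [S [Scomp TE]]].
have Sop := Scomp.1.
have [C xC] := basis_constant_of_basic xb.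
have [c [B [c0 xcB]]] := seminormalized_bounds xs.
have xc n : c <= nm (x n) by have /andP[] := xcB n.
have xB n : nm (x n) <= B by have /andP[] := xcB n.
have Vx i : closed_span x (x i).
  by apply: supported_closed_span (supported_unit _ (leqnn i) (ltnSn i)).
have Ty i : T (x i) = y i.
  by rewrite -{1}(psum_unit x (ltnSn i)) Txy psum_unit.
have Ssub (z : nat -> X) (M : R) : (forall n, closed_span x (z n)) ->
    (forall n, nm (z n) <= M) -> has_converging_subsequence (S \o z).
  apply: compact_operator_subsequence Scomp => [k v|k v].
  - exact: closed_spanZ.
  - exact: (opZ Sop).
have Sx i : S (x i) = y i - l *: x i.
  by rewrite -Ty TE// addrAC subrr add0r.
(* Both [S (x n)] and [y n - m *: x n] converge along a common subsequence, and
   they differ by [(m - l) *: x n]. *)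
have uniq_l m (k : nat -> nat) : increasing_seq k ->
    cvgn (fun n => y (k n) - m *: x (k n)) -> m = l.
  move=> kinc /cvg_ex[v kv].
  have [k' [k'inc /cvg_ex[w kw]]] :=
    Ssub (x \o k) B (fun n => Vx (k n)) (fun n => xB (k n)).
  apply/eqP; rewrite -subr_eq0; apply/eqP.
  apply: (@basic_no_cvg_subsequence x C c (k \o k')) => //.
    by move=> i j; rewrite /= kinc -leEnat k'inc.
  apply/cvg_ex; exists (w - v).
  rewrite (_ : (fun n => _) = (fun n => ((S \o (x \o k)) \o k') n -
    (y (k (k' n)) - m *: x (k (k' n))))).
    apply: cvgB => //.
    apply: (@cvg_reindex (fun n => y (k n) - m *: x (k n))) kv.
    by move=> n; exact: increasing_seq_ge.
  by apply/funext => n; rewrite /= Sx opprB [RHS]addrC subrKA scalerBl.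
case: hxy => [hi|[m [ym [z [w [zb zx wy zw nsub]]]]]|].
- apply: (hi l); have [k [kinc kc]] := Ssub x B Vx xB; exists k; split=> //.
  by rewrite (_ : _ \o k = (S \o x) \o k)//; apply/funext => n; rewrite /= Sx.
- have ml : m = l by exact: (uniq_l m id).
  have [M zM] := bounded_fun_nm zb.
  have Vz n : closed_span x (z n) by exact: closed_span_lspan.
  apply: nsub; rewrite (_ : (fun n => _) = S \o z); first exact: Ssub zM.
  apply/funext => n; have [N [a za]] := zx n.
  rewrite /= (zw n N a za) ml -[X in X - _ = _](Txy a N).
  by rewrite [psum x a N](esym za) (TE _ (Vz n)) addrAC subrr add0r.
- move=> [l1 [l2 [k1 [k2 [l12 k1i k2i h1 h2]]]]].
  by rewrite (uniq_l _ _ k1i h1) (uniq_l _ _ k2i h2) eqxx in l12.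
Qed.

End Topology.
End RealNorm.
(** * The real and the complex scalars *)

(** The intervals of radius [r n] around [u n] are nested, and the supremum of
    their left ends belongs to all of them. *)
Lemma real_telescoping_limit (R : realType) (u r : nat -> R) :
  (forall n, `|u n.+1 - u n| <= r n - r n.+1) -> (forall n, 0 <= r n) ->
  exists l, forall n, `|l - u n| <= r n.
Proof.
move=> ur r0.
have mono n p : u n - r n <= u (n + p)%N - r (n + p)%N /\
    u (n + p)%N + r (n + p)%N <= u n + r n.
  elim: p => [|p [IH1 IH2]]; first by rewrite addn0.
  rewrite addnS; have := ur (n + p)%N; rewrite ler_norml => /andP[h1 h2].
  by split; lra.
have cross n m : u n - r n <= u m + r m.
  have [h1 _] := mono n m; have [_ h2] := mono m n; rewrite addnC in h2.
  by have := r0 (n + m)%N; lra.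
pose A : set R := range (fun n => u n - r n).
have A0 : A !=set0 by exists (u 0%N - r 0%N), 0%N.
have Aub m : ubound A (u m + r m) by move=> _ [n _ <-].
exists (sup A) => n; rewrite ler_norml.
have : u n - r n <= sup A.
  by apply: ub_le_sup; [exists (u 0%N + r 0%N)|exists n].
by have := ge_sup A0 (Aub n); move=> h1 h2; apply/andP; split; lra.
Qed.

Lemma real_net (R : realType) (C e : R) : 0 < e ->
  exists s : seq R, forall a, `|a| <= C -> exists2 b, b \in s & `|a - b| <= e.
Proof.
move=> e0; exists [seq n%:R * e - C | n <- iota 0 (Num.truncn (2 * C / e)).+1].
move=> a; rewrite ler_norml => /andP[Ca aC].
have t0 : 0 <= (a + C) / e by apply: divr_ge0; [lra|exact: ltW].
exists ((Num.truncn ((a + C) / e))%:R * e - C).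
  apply/mapP; exists (Num.truncn ((a + C) / e)) => //.
  rewrite mem_iota/= add0n ltnS; apply: le_truncn.
  by rewrite ler_pM2r ?invr_gt0//; lra.
have /andP[] := truncn_itv t0; rewrite -natr1.
rewrite ler_pdivlMr// ltr_pdivrMr// => h1 h2.
by rewrite ler_norml; apply/andP; split; lra.
Qed.

Lemma real_scalars (R : realType) :
  @real_like_scalars R R (idfun : {rmorphism R -> R}) id.
Proof.
split=> //= [u r ur [r0 _]|C e]; last exact: real_net.
have [l hl] := real_telescoping_limit ur r0.
by exists l => n; have := hl n; have := r0 n; lra.
Qed.

Section ComplexScalars.
Context {R : realType}.
Implicit Types z : R[i].

Local Notation Re := complex.Re.
Local Notation Im := complex.Im.

Lemma Re_normE z : Re `|z| = Num.sqrt (Re z ^+ 2 + Im z ^+ 2).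
Proof. by rewrite normc_def. Qed.

Lemma normr_Re_le z : `|Re z| <= Re `|z|.
Proof. by rewrite Re_normE -sqrtr_sqr ler_wsqrtr// lerDl sqr_ge0. Qed.

Lemma normr_Im_le z : `|Im z| <= Re `|z|.
Proof. by rewrite Re_normE -sqrtr_sqr ler_wsqrtr// lerDr sqr_ge0. Qed.

Lemma Re_norm_le z : Re `|z| <= `|Re z| + `|Im z|.
Proof.
have s0 : 0 <= `|Re z| + `|Im z| by rewrite addr_ge0.
rewrite Re_normE -[leRHS]ger0_norm// -sqrtr_sqr ler_wsqrtr//.
rewrite sqrrD !real_normK ?num_real// -addrA lerD2l lerDr.
by rewrite mulrn_wge0// mulr_ge0.
Qed.

Lemma complex_scalars :
  @real_like_scalars R R[i] (real_complex R : {rmorphism R -> R[i]}) (@Re R).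
Proof.
split=> [s t|k|u r ur [r0 _]|C e e0].
- exact: lecR.
- exact: RRe_real.
- have [|//|l1 h1] := @real_telescoping_limit R (fun n => Re (u n)) r.
    move=> n; apply: le_trans (ur n); apply: le_trans (normr_Re_le _).
    by case: (u n.+1) => ? ?; case: (u n).
  have [|//|l2 h2] := @real_telescoping_limit R (fun n => Im (u n)) r.
    move=> n; apply: le_trans (ur n); apply: le_trans (normr_Im_le _).
    by case: (u n.+1) => ? ?; case: (u n).
  exists (Complex l1 l2) => n; apply: le_trans (Re_norm_le _) _.
  by have := h1 n; have := h2 n; case: (u n) => a b /=; lra.
- have [s hs] := real_net C (divr_gt0 e0 (ltr0Sn R 1)).
  exists [seq Complex a b | a <- s, b <- s] => z zC.
  have [a as_ za] := hs _ (le_trans (normr_Re_le z) zC).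
  have [b bs zb] := hs _ (le_trans (normr_Im_le z) zC).
  exists (Complex a b); first by apply/allpairsP; exists (a, b).
  apply: le_trans (Re_norm_le _) _; move: za zb; case: z {zC} => c d /=; lra.
Qed.

End ComplexScalars.

Theorem proposition1p3 (R : realType) :
  (forall X : completeNormedModType R,
     has_nontrivial_operator X <-> has_nontrivial_dominated_sequence X) /\
  (forall X : completeNormedModType R[i],
     has_nontrivial_operator X <-> has_nontrivial_dominated_sequence X).
Proof.
split=> X; split.
- exact: (dominated_sequence_of_operator (real_scalars R)).
- exact: (operator_of_dominated_sequence (real_scalars R)).
- exact: (dominated_sequence_of_operator complex_scalars).
- exact: (operator_of_dominated_sequence complex_scalars).
Qed.
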